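(* Every rank-uniform semimodular supersolvable lattice is UMEL-shellable.
   Context: All posets are finite, bounded (minimum $\hat 0$, maximum $\hat 1$) and graded with rank function $\mathrm{rk}$, $\mathrm{rk}(\hat 0)=0$; the rank of $P$ is $\mathrm{rk}(\hat 1)$. Write $s\lessdot t$ if $t$ covers $s$, and $\mathcal E(P)$ for the set of covering pairs. Rank-uniform poset: $P$ is rank-uniform if for all $s,t\in P$ of the same rank and every positive integer $k$, the number of elements $u\ge s$ of rank $\mathrm{rk}(s)+k$ equals the number of elements $u\ge t$ of rank $\mathrm{rk}(t)+k$. Lattices. A pair $(s,t)$ in a lattice $L$ is modular if $u\vee(s\wedge t)=(u\vee s)\wedge t$ for all $u\le t$. An element $s$ is left modular if $(s,t)$ is modular for all $t\in L$. A finite lattice is supersolvable if it is graded and has a maximal chain consisting of left modular elements. A graded finite lattice is semimodular if $\mathrm{rk}(s\vee t)+\mathrm{rk}(s\wedge t)\le\mathrm{rk}(s)+\mathrm{rk}(t)$ for all $s,t$. UMEL-shellability. An edge labeling is a map $\lambda:\mathcal E(P)\to\Lambda$ to a totally ordered set $(\Lambda,\vartriangleleft)$. It is an EL-labeling if for all $s\le t$ there is a unique maximal chain $s=u_0\lessdot\cdots\lessdot u_k=t$ of $[s,t]$ with weakly increasing labels $\lambda(u_0,u_1)\trianglelefteq\cdots\trianglelefteq\lambda(u_{k-1},u_k)$, and its label sequence is lexicographically minimal among all maximal chains of $[s,t]$. An EL-labeled poset is a pair $(P,\lambda)$ with $\lambda$ an EL-labeling of $P$. For $s\in P$ let $\lambda_1\vartriangleleft\cdots\vartriangleleft\lambda_\ell$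 be the distinct labels $\lambda(s,t)$, $t\gtrdot s$ (the labels above $s$). The width is $\omega_s(i)=|\{t: s\lessdot t,\ \lambda(s,t)=\lambda_i\}|$ (equal to $0$ for $i>\ell$). For $s\lessdot t$, $\mathrm{Ind}(s,t)$ is the $i$ with $\lambda(s,t)=\lambda_i$, and $\mathrm{des}_s(t)$ is the number of distinct labels above $t$ that are $\vartriangleleft\lambda(s,t)$. $(P,\lambda)$ is a rank-uniform labeled poset if (1) $\omega_s(i)=\omega_{s'}(i)$ for all $s,s'$ of the same rank and all $i\ge1$; and (2) $\mathrm{des}_s(t)=\mathrm{des}_{s'}(t')$ whenever $s\lessdot t$, $s'\lessdot t'$, $\mathrm{rk}(s)=\mathrm{rk}(s')$ and $\mathrm{Ind}(s,t)=\mathrm{Ind}(s',t')$. In that case $\mathrm{des}_k(i)$ denotes $\mathrm{des}_s(t)$ for any $s$ of rank $k$ and $t\gtrdot s$ with $\mathrm{Ind}(s,t)=i$, and $\ell_k$ is the number of distinct labels above any element of rank $k$. It is monotonic if for every $0\le k\le \mathrm{rk}(P)-1$ the function $i\mapsto\mathrm{des}_k(i)$ is weakly increasing on $\{1,\dots,\ell_k\}$. $P$ is UMEL-shellable if it admits an EL-labeling $\lambda$ such that $(P,\lambda)$ is a monotonic rank-uniform labeled poset. *)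

(* Defs.v *)
From mathcomp Require Import all_boot all_order.
Import Order.Theory.

Set Implicit Arguments.
Unset Strict Implicit.
Unset Printing Implicit Defensive.

Local Open Scope order_scope.

(** * Finite bounded graded posets *)

Definition covers d (P : finTBPOrderType d) (s t : P) : bool :=
  (s < t) && [forall u, ~~ (s < u < t)].

(* Determines [rk] uniquely, since every element is reached from [\bot] by a
   chain of covers. *)
Definition is_rank d (P : finTBPOrderType d) (rk : P -> nat) : Prop :=
  rk \bot = 0%N /\ forall s t : P, covers s t -> rk t = (rk s).+1.

Definition graded d (P : finTBPOrderType d) : Prop :=
  exists rk : P -> nat, is_rank rk.

(* [s :: p] is a maximal chain s = u_0 <. u_1 <. ... <. u_k = t of [s, t];
   the bottom element [s] is not repeated in [p]. *)
Definition maxchain d (P : finTBPOrderType d) (s t : P) (p : seq P) : bool :=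
  path (@covers d P) s p && (last s p == t).

Definition rank_uniform d (P : finTBPOrderType d) (rk : P -> nat) : Prop :=
  forall s t : P, rk s = rk t -> forall k : nat, (0 < k)%N ->
    #|[set u : P | (s <= u) && (rk u == rk s + k)%N]| =
    #|[set u : P | (t <= u) && (rk u == rk t + k)%N]|.

(** * Lattices *)

Definition modular_pair d (L : finTBLatticeType d) (s t : L) : Prop :=
  forall u : L, u <= t -> u `|` (s `&` t) = (u `|` s) `&` t.

Definition left_modular d (L : finTBLatticeType d) (s : L) : Prop :=
  forall t : L, modular_pair s t.

Definition supersolvable d (L : finTBLatticeType d) : Prop :=
  graded L /\
  exists p : seq L, maxchain \bot \top p /\
    forall s : L, s \in \bot :: p -> left_modular s.

Definition semimodular d (L : finTBLatticeType d) (rk : L -> nat) : Prop :=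
  forall s t : L, (rk (s `|` t) + rk (s `&` t) <= rk s + rk t)%N.

(** * Edge labelings

  An edge labeling is a function [lam : P -> P -> Lam] of which only the values
  on covering pairs are ever used. *)

Definition labels d d' (P : finTBPOrderType d) (Lam : orderType d')
    (lam : P -> P -> Lam) (s : P) (p : seq P) : seq Lam :=
  pairmap lam s p.

Definition EL_labeling d d' (P : finTBPOrderType d) (Lam : orderType d')
    (lam : P -> P -> Lam) : Prop :=
  forall s t : P, s <= t ->
    exists p : seq P,
      [/\ maxchain s t p,
          sorted <=%O (labels lam s p),
          forall q : seq P, maxchain s t q -> sorted <=%O (labels lam s q) ->
            q = p
        & forall q : seq P, maxchain s t q ->
            (labels lam s p : seqlexi Lam) <= (labels lam s q : seqlexi Lam)].

(* The distinct labels above [s], in increasing order. *)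
Definition labels_above d d' (P : finTBPOrderType d) (Lam : orderType d')
    (lam : P -> P -> Lam) (s : P) : seq Lam :=
  sort <=%O (undup [seq lam s t | t <- enum P & covers s t]).

(* Indices are 1-based: lambda_i is entry [i.-1] of [labels_above lam s], for
   [1 <= i]; [onth] is [None], hence the width is 0, past the last label. *)
Definition width d d' (P : finTBPOrderType d) (Lam : orderType d')
    (lam : P -> P -> Lam) (s : P) (i : nat) : nat :=
  #|[set t : P | covers s t & onth (labels_above lam s) i.-1 == Some (lam s t)]|.

Definition Ind d d' (P : finTBPOrderType d) (Lam : orderType d')
    (lam : P -> P -> Lam) (s t : P) : nat :=
  (index (lam s t) (labels_above lam s)).+1.

Definition des d d' (P : finTBPOrderType d) (Lam : orderType d')
    (lam : P -> P -> Lam) (s t : P) : nat :=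
  count (fun a => a < lam s t) (labels_above lam t).

Definition rank_uniform_labeled d d' (P : finTBPOrderType d) (rk : P -> nat)
    (Lam : orderType d') (lam : P -> P -> Lam) : Prop :=
  (forall s s' : P, rk s = rk s' ->
     forall i : nat, (1 <= i)%N -> width lam s i = width lam s' i) /\
  (forall s t s' t' : P, covers s t -> covers s' t' -> rk s = rk s' ->
     Ind lam s t = Ind lam s' t' -> des lam s t = des lam s' t').

(* For a rank-uniform labeled poset, the values of [des_rank] (for an index [i]
   between 1 and [num_labels rk lam k]) and of [num_labels] (for [k] at most the
   rank of the poset) do not depend on the element picked. *)
Definition des_rank d d' (P : finTBPOrderType d) (rk : P -> nat)
    (Lam : orderType d') (lam : P -> P -> Lam) (k i : nat) : nat :=
  if [pick st : P * P | [&& covers st.1 st.2, rk st.1 == k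
                          & Ind lam st.1 st.2 == i]] is Some st
  then des lam st.1 st.2 else 0%N.

Definition num_labels d d' (P : finTBPOrderType d) (rk : P -> nat)
    (Lam : orderType d') (lam : P -> P -> Lam) (k : nat) : nat :=
  if [pick s : P | rk s == k] is Some s then size (labels_above lam s) else 0%N.

Definition monotonic d d' (P : finTBPOrderType d) (rk : P -> nat)
    (Lam : orderType d') (lam : P -> P -> Lam) : Prop :=
  forall k : nat, (k < rk \top)%N ->
  forall i j : nat, (1 <= i)%N -> (i <= j)%N -> (j <= num_labels rk lam k)%N ->
    (des_rank rk lam k i <= des_rank rk lam k j)%N.

Definition UMEL_shellable d (P : finTBPOrderType d) (rk : P -> nat) : Prop :=
  exists (d' : Order.disp_t) (Lam : orderType d') (lam : P -> P -> Lam),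
    [/\ EL_labeling lam, rank_uniform_labeled rk lam & monotonic rk lam].

(* Main.v *)
Require Import Defs.
From mathcomp Require Import all_boot all_order.
From mathcomp Require Import zify.
Import Order.Theory.

(** Let [m_0 = \bot <. m_1 <. ... <. m_n = \top] be a maximal chain of left
    modular elements, and label the edge [s <. t] by the least [i] such that
    [t <= s `|` m_i].  Left modularity gives the dual description [lab_gt]: the
    label exceeds [i] exactly when [m_i `&` t <= s].

    This is an EL-labeling.  For [s < t], let [i] be least with
    [m_i `&` t] not below [s].  All labels in [[s, t]] are at least [i];
    semimodularity makes [v = s `|` (m_i `&` t)] a cover of [s], which is the
    only cover of [s] below [t] with label [i]; and a chain from [s] to [t]
    whose labels all exceed [i] would give [m_i `&` t <= s].  So a rising chain
    has to start with [v], and induction on [[v, t]] concludes ([lab_EL]).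

    The key to the widths is that an edge [s <. b] hides nothing below its own
    label: for [j < lab s b], the map [c |-> c `|` b] is a bijection from the
    covers of [s] with label [j] to the covers of [b] with label [j]
    ([card_covers_lab]).  Hence the labels above [b] smaller than [lab s b] are
    the labels above [s] smaller than [lab s b], so that [des lab s b] is one
    less than the index of the edge ([des_Ind]).  This settles the condition on
    descents and monotonicity at once.

    It remains to see that the sequence of widths at [s] depends only on the
    rank of [s] ([eq_widths_of_rank]), by descending induction on the rank.
    If [b] covers [s] with the largest possible label, the widths at [s] other
    than the last one form a prefix of the sequence of widths at [b], which is
    known by induction.  Rank-uniformity fixes two more quantities: the sum of
    the widths, which is the number of covers of [s], and the sum of their
    squares.  For the latter, the elements two ranks above [s] correspond to the
    rising paths [s <. b <. y]; the other paths [s <. b <. y] correspond, by the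
    bijection above, to the pairs of covers of [s] with distinct labels.  Thus
    the number of such pairs depends only on the rank of [s], and so does the
    number of pairs with equal labels, which is the sum of the squares.  A
    sequence of positive numbers which is a prefix of a given sequence followed
    by one more term is determined by its sum and its sum of squares
    ([eq_from_sum_sum_sqr]). *)

Set Implicit Arguments.
Unset Strict Implicit.
Unset Printing Implicit Defensive.

Local Open Scope order_scope.

(** * Two counting lemmas *)

Lemma sum_sqr_le (l : seq nat) :
  (\sum_(x <- l) x ^ 2 <= (\sum_(x <- l) x) ^ 2)%N.
Proof.
elim: l => [|x l IHl]; first by rewrite !big_nil.
by rewrite !big_cons sqrnD -addnA leq_add2l (leq_trans IHl) // leq_addr.
Qed.

(** If [l] is nonempty and not longer than [l'], then [l = rcons a x] and
    [l' = a ++ r] with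
    [r] nonempty, where [x] is the sum of [r] and [x ^ 2] the sum of the squares
    of [r].  As the entries of [r] are positive, it has a single entry. *)
Lemma eq_from_sum_sum_sqr (v l l' : seq nat) :
  all (fun x => 0 < x)%N l -> all (fun x => 0 < x)%N l' ->
  take (size l).-1 l = take (size l).-1 v ->
  take (size l').-1 l' = take (size l').-1 v ->
  (\sum_(x <- l) x = \sum_(x <- l') x)%N ->
  (\sum_(x <- l) x ^ 2 = \sum_(x <- l') x ^ 2)%N ->
  l = l'.
Proof.
wlog le_ll' : l l' / (size l <= size l')%N => [IH|].
  move=> l_gt0 l'_gt0 l_v l'_v sum_eq sqr_eq.
  have [le_ll'|/ltnW le_l'l] := leqP (size l) (size l'); first exact: IH.
  by apply/esym; apply: IH.
case: (lastP l) le_ll' => [|a x] + l_gt0 l'_gt0 + l'_v.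
  case: l' l'_gt0 l'_v => // x l' /= /andP[x_gt0 _] _ _ _.
  by rewrite big_nil big_cons => sum_eq _; lia.
rewrite size_rcons /= -cats1 take_size_cat // => lt_al' a_v.
have l'_eq : l' = a ++ drop (size a) l'.
  rewrite -[LHS](cat_take_drop (size a)) a_v; congr (_ ++ _).
  have le_a : (size a <= (size l').-1)%N by lia.
  by rewrite -a_v -(take_takel l' le_a) l'_v take_takel.
case: (drop _ _) l'_eq => [|y [|z b]] l'_eq.
- by rewrite l'_eq cats0 ltnn in lt_al'.
- by rewrite l'_eq !big_cat /= !big_seq1 => /addnI->.
rewrite l'_eq !big_cat /= !big_seq1 !(big_cons _ _ y) => /addnI-> /addnI /eqP.
(* Two entries or more: the cross terms of the square are positive. *)
move: l'_gt0; rewrite l'_eq all_cat => /and4P[_ y_gt0 z_gt0 _].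
rewrite sqrnD -addnA eqn_add2l => /eqP.
have := sum_sqr_le (z :: b).
have : (0 < \sum_(j <- z :: b) j)%N by rewrite big_cons; lia.
nia.
Qed.

Lemma sum_by_value (T : finType) (A : pred T) (g : T -> nat) (l : seq nat)
    (F : nat -> nat) : uniq l -> (forall t, A t -> g t \in l) ->
  (\sum_(j <- l) #|[set t | A t & g t == j]| * F j = \sum_(t | A t) F (g t))%N.
Proof.
move=> uniq_l g_l.
transitivity (\sum_(t | A t) \sum_(j <- l | g t == j) F j)%N; last first.
  apply: eq_bigr => t /g_l g_t; under eq_bigl do rewrite eq_sym.
  by rewrite -big_filter filter_pred1_uniq // big_seq1.
rewrite (exchange_big_dep predT) //=; apply: eq_bigr => j _.
by rewrite -sum1dep_card big_distrl /=; apply: eq_bigr => t _; rewrite mul1n.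
Qed.

(** * Rank functions *)

Section Rank.

Context (d : Order.disp_t) (P : finTBPOrderType d).
Implicit Types s t u : P.

Lemma covers_lt s t : covers s t -> s < t.
Proof. by case/andP. Qed.

Lemma exists_cover_below s t : s < t -> exists2 c, covers s c & c <= t.
Proof.
have [n] := ubnP #|[set u | s < u <= t]|.
elim: n t => // n IHn t le_n lt_st.
have [cov_st|] := boolP (covers s t); first by exists t.
rewrite /covers lt_st /= negb_forall => /existsP[u]; rewrite negbK => /andP[lt_su lt_ut].
have [|//|c cov_sc le_cu] := IHn u.
  rewrite -ltnS (leq_trans _ le_n) // ltnS; apply/proper_card/properP; split.
    apply/subsetP=> v; rewrite !inE => /andP[-> le_vu].
    exact: le_trans le_vu (ltW lt_ut).
  by exists t; rewrite !inE lt_st ?lexx //= lt_geF.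
by exists c => //; apply: le_trans le_cu (ltW lt_ut).
Qed.

Lemma maxchain_cons s t y q :
  maxchain s t (y :: q) = covers s y && maxchain y t q.
Proof. by rewrite /maxchain /= andbA. Qed.

Lemma maxchain_le s t q : maxchain s t q -> s <= t.
Proof.
elim: q s => [|y q IHq] s; first by rewrite /maxchain /= => /eqP->.
by rewrite maxchain_cons => /andP[/covers_lt/ltW le_sy /IHq]; apply: le_trans.
Qed.

Lemma maxchain_refl s q : maxchain s s q -> q = [::].
Proof.
case: q => // y q; rewrite maxchain_cons => /andP[/covers_lt lt_sy /maxchain_le].
by rewrite lt_geF.
Qed.

Context (rk : P -> nat) (rkP : is_rank rk).

Lemma rk_covers s t : covers s t -> rk t = (rk s).+1.
Proof. by case: rkP => _; apply. Qed.

Lemma rk_lt s t : s < t -> (rk s < rk t)%N.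
Proof.
have [n] := ubnP #|[set u | s < u <= t]|.
elim: n s => // n IHn s le_n lt_st.
have [c cov_sc] := exists_cover_below lt_st.
rewrite le_eqVlt => /predU1P[<-|lt_ct]; first by rewrite -(rk_covers cov_sc).
have lt_sc := covers_lt cov_sc.
rewrite (@ltn_trans (rk c)) -?(rk_covers cov_sc) // IHn //.
rewrite -ltnS (leq_trans _ le_n) // ltnS; apply/proper_card/properP; split.
  apply/subsetP=> v; rewrite !inE => /andP[lt_cv ->].
  by rewrite (lt_trans lt_sc lt_cv).
by exists c; rewrite !inE ?ltxx // lt_sc ltW.
Qed.

Lemma rk_le s t : s <= t -> (rk s <= rk t)%N.
Proof. by rewrite le_eqVlt => /predU1P[->//|/rk_lt/ltnW]. Qed.

Lemma rk_le_eq s t : s <= t -> (rk t <= rk s)%N -> s = t.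
Proof.
by rewrite le_eqVlt => /predU1P[->//|/rk_lt]; rewrite ltnNge => /negPf->.
Qed.

Lemma rk_maxchain s t q : maxchain s t q -> rk t = (rk s + size q)%N.
Proof.
elim: q s => [|y q IHq] s; first by rewrite /maxchain /= addn0 => /eqP->.
by rewrite maxchain_cons => /andP[/rk_covers rk_y /IHq->]; rewrite rk_y addSnnS.
Qed.

Lemma coversE s t : covers s t = (s <= t) && (rk t == (rk s).+1)%N.
Proof.
apply/idP/andP=> [cov_st | [le_st /eqP rk_t]].
  by rewrite (rk_covers cov_st) (ltW (covers_lt cov_st)).
have lt_st : s < t.
  by rewrite lt_neqAle le_st andbT; apply/eqP=> e; rewrite e in rk_t; lia.
rewrite /covers lt_st; apply/forallP=> u; apply/negP=> /andP[/rk_lt + /rk_lt].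
lia.
Qed.

End Rank.

(** * The edge labeling of a left modular chain *)

Section Labeling.

Context (d : Order.disp_t) (L : finTBLatticeType d) (rk : L -> nat).
Hypotheses (rkP : is_rank rk) (smod : semimodular rk).
Context (p : seq L) (p_max : maxchain \bot \top p)
  (p_lm : forall s : L, s \in \bot :: p -> left_modular s).
Implicit Types s t u v b c y : L.

(** The default value makes the chain constantly [\top] beyond its end, so that
    statements on its elements need no bound on the index. *)
Definition chain_elt (i : nat) : L := nth \top (\bot :: p) i.
Local Notation m := chain_elt.

Lemma chain_top i : (size p <= i)%N -> m i = \top.
Proof.
case/andP: p_max => _ /eqP last_p; rewrite leq_eqVlt => /predU1P[<-|lt_i].
  by rewrite -[RHS]last_p (last_nth \top).
by rewrite /m nth_default.
Qed.

Lemma chain_left_modular i t u : u <= t -> u `|` (m i `&` t) = (u `|` m i) `&` t.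
Proof.
apply: p_lm; have [le_i|lt_i] := leqP (size p) i; last by rewrite mem_nth // ltnW.
by rewrite chain_top //; case/andP: p_max => _ /eqP <-; apply: mem_last.
Qed.

Lemma chain_step i : m i <= m i.+1 /\ (rk (m i.+1) <= (rk (m i)).+1)%N.
Proof.
have [lt_i|le_i] := ltnP i (size p); last first.
  by rewrite !chain_top // ltnW.
case/andP: p_max => /(pathP \top)/(_ i lt_i) c _.
by rewrite (ltW (covers_lt c)) (rk_covers rkP c).
Qed.

Definition lab s t : nat := find (fun x => t <= s `|` x) (\bot :: p).

Lemma chain_le i j : (i <= j)%N -> m i <= m j.
Proof.
move=> /subnK <-; elim: (j - i)%N => // k IHk.
exact: le_trans IHk (chain_step _).1.
Qed.

Lemma lab_le s t i : (lab s t <= i)%N = (t <= s `|` m i).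
Proof.
apply/idP/idP=> [le_i | le_t].
  suff le_lab: t <= s `|` m (lab s t).
    by apply: le_trans le_lab _; rewrite leU2 ?chain_le.
  apply: (@nth_find _ \top (fun x => t <= s `|` x)); apply/hasP; exists \top.
    by rewrite -(chain_top (leqnn _)) mem_nth.
  by rewrite joinx1 lex1.
rewrite leqNgt; apply/negP=> /(@before_find _ \top); rewrite -/(m i).
by rewrite le_t.
Qed.

(** By left modularity, [s `|` (m i `&` t) = (s `|` m i) `&` t]; as [t] covers [s]
    this element is [s] or [t], and either form tells which. *)
Lemma lab_gt s t i : covers s t -> (i < lab s t)%N = (m i `&` t <= s).
Proof.
move=> cov_st; have lt_st := covers_lt cov_st.
have mod_i := chain_left_modular i (ltW lt_st).
rewrite ltnNge lab_le; apply/idP/idP=> [nle_t | le_s].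
  have: ~~ (s < s `|` (m i `&` t) < t).
    by move: cov_st; rewrite /covers => /andP[_ /forallP].
  rewrite !lt_neqAle leUl leUx (ltW lt_st) leIr !andbT negb_and !negbK.
  case/orP=> /eqP e; first by rewrite e leUr.
  by rewrite -[X in X <= _]e leU2 ?leIl in nle_t.
apply/negP=> le_t; move: mod_i; rewrite (meet_r le_t) (join_l le_s) => e.
by rewrite e ltxx in lt_st.
Qed.

(** Left modularity makes the meets of the chain with [t] a chain without gaps:
    an [x] below [m i.+1 `&` t] that covers [m i `&` t] satisfies
    [x `|` m i = m i.+1], whence [x = (x `|` m i) `&` t = m i.+1 `&` t]. *)
Lemma rk_meet_chain_step i t : (rk (m i.+1 `&` t) <= (rk (m i `&` t)).+1)%N.
Proof.
have [le_m rk_m] := chain_step i.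
have: m i `&` t <= m i.+1 `&` t by rewrite leI2.
rewrite le_eqVlt => /predU1P[<-|]; first exact: leqnSn.
move=> /(exists_cover_below)[x cov_x]; rewrite lexI => /andP[le_xm le_xt].
rewrite -(rk_covers rkP cov_x); apply: (rk_le rkP).
suff <-: x `|` m i = m i.+1.
  by rewrite -chain_left_modular // leUx lexx (ltW (covers_lt cov_x)).
apply: (rk_le_eq rkP); first by rewrite leUx le_xm.
apply: leq_trans rk_m (rk_lt rkP _); rewrite lt_neqAle leUr andbT.
apply/eqP=> /esym/eqP; rewrite -leEjoin => le_xmi.
by have := lt_geF (covers_lt cov_x); rewrite lexI le_xmi le_xt.
Qed.

(** The first step of the rising chain of [[s, t]]: [i] is the least index such
    that [m i `&` t] is not below [s], and [v = s `|` (m i `&` t)]. *)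
Lemma min_label_cover s t : s < t ->
  exists v i, [/\ covers s v, v <= t, lab s v = i, m i `&` t <= v &
    [/\ ~~ (m i `&` t <= s),
       forall c y, s <= c -> covers c y -> y <= t -> (i <= lab c y)%N &
       forall v', covers s v' -> v' <= t -> lab s v' = i -> v' = v]].
Proof.
move=> lt_st.
have ex_i : exists i, ~~ (m i `&` t <= s).
  by exists (size p); rewrite chain_top // meet1x lt_geF.
case: (ex_minnP ex_i) => i nle_i min_i.
case: i => [|i] in nle_i min_i *; first by rewrite meet0x le0x in nle_i.
have le_i : m i `&` t <= s by apply/negPn/negP=> /min_i; rewrite ltnn.
pose v := s `|` (m i.+1 `&` t).
have le_vt : v <= t by rewrite leUx (ltW lt_st) leIr.
have cov_sv : covers s v.
  rewrite (coversE rkP) leUl eqn_leq /=.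
  rewrite [X in _ && X](rk_lt rkP) ?andbT; last first.
    by rewrite lt_neqAle leUl andbT eq_sym /v eq_joinl.
  (* Joining with [s] cannot raise the rank by more than the passage from
     [m i `&` t], already below [s], to [m i.+1 `&` t]. *)
  have := smod s (m i.+1 `&` t); rewrite -/v.
  have := rk_meet_chain_step i t.
  have: (rk (m i `&` t) <= rk (s `&` (m i.+1 `&` t)))%N.
    by apply: (rk_le rkP); rewrite lexI le_i leI2 // (chain_step i).1.
  lia.
have lab_min c y : s <= c -> covers c y -> y <= t -> (i < lab c y)%N.
  move=> le_sc cov_cy le_yt; rewrite lab_gt //.
  by apply: le_trans le_sc; apply: le_trans le_i; rewrite leI2.
have lab_v : lab s v = i.+1.
  by apply/eqP; rewrite eqn_leq lab_min // andbT lab_le leU2 // leIl.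
exists v, i.+1; split=> //; first exact: leUr.
split=> // v' cov_sv' le_v't lab_v'.
apply: (rk_le_eq rkP); last by rewrite (rk_covers rkP cov_sv) (rk_covers rkP cov_sv').
rewrite /v chain_left_modular ?(ltW lt_st) // lexI le_v't andbT.
by rewrite -lab_le lab_v'.
Qed.

Lemma maxchain_labels_gt i s t u q : maxchain s t q -> t <= u ->
  m i `&` u <= s -> all (fun a => (i < a)%N) (labels lab s q).
Proof.
elim: q s => //= y q IHq s; rewrite maxchain_cons => /andP[cov_sy max_q] le_tu le_s.
rewrite lab_gt // (le_trans _ le_s) ?leI2 ?(le_trans (maxchain_le max_q)) //=.
by apply: IHq => //; apply: le_trans le_s (ltW (covers_lt cov_sy)).
Qed.

Lemma labels_gt_meet_le i s t q : maxchain s t q ->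
  all (fun a => (i < a)%N) (labels lab s q) -> m i `&` t <= s.
Proof.
elim: q s => [|y q IHq] s /=; first by rewrite /maxchain /= => /eqP-> _; apply: leIr.
rewrite maxchain_cons => /andP[cov_sy max_q] /andP[lt_i all_q].
apply: le_trans (_ : m i `&` y <= s); last by rewrite -lab_gt.
by rewrite lexI leIl IHq.
Qed.

(** The rising chain is built greedily from [min_label_cover].  Another rising
    chain starting with a label above the minimum [i] would have all its labels
    above [i], contradicting [labels_gt_meet_le]. *)
Lemma lab_EL : EL_labeling lab.
Proof.
move=> s t; have [n] := ubnP (rk t - rk s)%N; elim: n s => // n IHn s lt_n.
rewrite le_eqVlt => /predU1P[<-|lt_st].
  exists [::]; split=> [|//|q|q /maxchain_refl->//].
    by rewrite /maxchain /=.
  by move=> /maxchain_refl.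
have [v [i [cov_sv le_vt lab_v le_v [nle_s lab_min v_uniq]]]] := min_label_cover lt_st.
have [|//|q [max_q sort_q uniq_q lex_q]] := IHn v.
  by have := rk_lt rkP lt_st; rewrite (rk_covers rkP cov_sv); lia.
have first_cases q' : maxchain s t q' -> exists y r,
    [/\ q' = y :: r, covers s y, (i <= lab s y)%N & maxchain y t r
      /\ (lab s y = i -> y = v)].
  case: q' => [|y r]; first by rewrite /maxchain /= lt_eqF.
  rewrite maxchain_cons => /andP[cov_sy max_r]; exists y, r.
  have le_yt := maxchain_le max_r.
  by split=> //; [exact: lab_min | split=> // /v_uniq->].
exists (v :: q); split.
- by rewrite maxchain_cons cov_sv.
- rewrite /= path_sortedE; last exact: le_trans.
  rewrite [X in _ && X]sort_q andbT lab_v.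
  apply: sub_all (maxchain_labels_gt max_q (lexx _) le_v) => a /=.
  exact: ltnW.
- move=> q' /first_cases[y [r [-> cov_sy le_i [max_r y_v]]]] /=.
  rewrite path_sortedE => [/andP[all_r sort_r]|]; last exact: le_trans.
  move: le_i; rewrite leq_eqVlt => /predU1P[/esym/y_v y_eq|lt_i].
    by rewrite y_eq in max_r sort_r *; rewrite (uniq_q r).
  case/negP: nle_s; apply: (@labels_gt_meet_le i s t (y :: r)).
    by rewrite maxchain_cons cov_sy.
  rewrite /= lt_i; apply: sub_all all_r => a /=; exact: leq_trans lt_i.
move=> q' /first_cases[y [r [-> cov_sy le_i [max_r y_v]]]] /=.
rewrite lexi_cons lab_v [X in X && _]le_i /=; apply/implyP=> le_lab.
have y_eq : y = v by apply: y_v; apply/eqP; rewrite eqn_leq le_i andbT.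
by rewrite y_eq in max_r *; apply: lex_q.
Qed.

(** * Covers sorted by label and their transfer along an edge *)

Definition covers_lab s j : {set L} := [set t | covers s t & lab s t == j].

Lemma covers_join s b c : covers s b -> covers s c -> b != c -> covers b (c `|` b).
Proof.
move=> cov_sb cov_sc neq_bc; rewrite (coversE rkP) leUr /= eqn_leq.
apply/andP; split.
  have := smod c b; rewrite !(rk_covers rkP cov_sb, rk_covers rkP cov_sc).
  have : (rk s <= rk (c `&` b))%N.
    by rewrite (rk_le rkP) // lexI !ltW ?covers_lt.
  lia.
apply: (rk_lt rkP); rewrite lt_neqAle leUr andbT eq_sym eq_joinr.
apply: contra neq_bc => le_cb; rewrite eq_sym; apply/eqP/(rk_le_eq rkP) => //.
by rewrite (rk_covers rkP cov_sb) (rk_covers rkP cov_sc).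
Qed.

(** If [lab b (c `|` b)] were some [i < lab s c], put [x = s `|` m i].  Then [c] is
    below [b `|` x] but not below [x], and [b `|` x] has rank at most one more
    than [x].  So [c `|` x = b `|` x], and [b] is below [s `|` m (lab s c)],
    contradicting [lab s c < lab s b]. *)
Lemma lab_join s b c : covers s b -> covers s c -> (lab s c < lab s b)%N ->
  lab b (c `|` b) = lab s c.
Proof.
move=> cov_sb cov_sc lt_cb; apply/eqP; rewrite eqn_leq lab_le.
have le_c := leqnn (lab s c); rewrite lab_le in le_c.
have le_sb := ltW (covers_lt cov_sb).
rewrite leUx leUl andbT (le_trans le_c) ?leU2 //=.
rewrite leqNgt; apply/negP; set i := lab b _ => lt_i.
have /(le_trans (leUl _ _)) : c `|` b <= b `|` m i by rewrite -lab_le.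
rewrite -[b](join_l le_sb) -joinA => le_cx; set x := s `|` m i in le_cx.
have nle_cx : ~~ (c <= x) by rewrite -lab_le -ltnNge.
have lt_x : x < c `|` x by rewrite lt_neqAle leUr eq_sym eq_joinr nle_cx.
have eq_join : c `|` x = b `|` x.
  apply: (rk_le_eq rkP); first by rewrite leUx le_cx leUr.
  apply: leq_trans (rk_lt rkP lt_x).
  have := smod b x; rewrite (rk_covers rkP cov_sb).
  have : (rk s <= rk (b `&` x))%N by rewrite (rk_le rkP) // lexI le_sb leUl.
  lia.
move: lt_cb; rewrite ltnNge lab_le => /negP[].
apply: le_trans (leUl b x) _; rewrite -eq_join leUx le_c.
by rewrite leU2 // chain_le // ltnW.
Qed.

(** A cover [y] of [b] with label [j] is reached from the first element
    [c = s `|` (m j `&` y)] of the rising chain of [[s, y]]: left modularity of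
    [m j] gives [c `|` b = y]. *)
Lemma covers_lab_join s b j : covers s b -> (j < lab s b)%N ->
  covers_lab b j = [set c `|` b | c in covers_lab s j].
Proof.
move=> cov_sb lt_j; apply/setP=> y; rewrite inE; apply/andP/imsetP.
  case=> cov_by /eqP lab_y.
  have [lt_sb lt_by] := (covers_lt cov_sb, covers_lt cov_by).
  pose c := s `|` (m j `&` y).
  have y_eq : y = c `|` b.
    have := chain_left_modular j (ltW lt_by).
    rewrite [in RHS]meet_r -?lab_le ?lab_y // => e.
    by rewrite /c joinAC (join_r (ltW lt_sb)) e.
  have neq_cs : s != c.
    by apply: contraTneq lt_by => s_eq; rewrite y_eq -s_eq (join_r (ltW lt_sb)) ltxx.
  have lt_cy : c < y.
    rewrite lt_neqAle leUx (ltW (lt_trans lt_sb lt_by)) leIr !andbT.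
    apply: contraTneq lt_j => c_eq; rewrite -leqNgt lab_le.
    by rewrite (le_trans (ltW lt_by)) // -c_eq leU2 ?leIl.
  have cov_sc : covers s c.
    have lt_sc : s < c by rewrite lt_neqAle neq_cs leUl.
    rewrite (coversE rkP) leUl eqn_leq (rk_lt rkP lt_sc) andbT -ltnS.
    by rewrite -(rk_covers rkP cov_sb) -(rk_covers rkP cov_by) (rk_lt rkP).
  exists c => //; rewrite inE cov_sc eqn_leq lab_le leU2 ?leIl //=.
  rewrite leqNgt; apply/negP; set i := lab s c => lt_i.
  have le_c : c <= s `|` m i by rewrite -lab_le.
  suff: (lab b y <= i)%N by rewrite lab_y leqNgt lt_i.
  by rewrite lab_le y_eq leUx leUl andbT (le_trans le_c) // leU2 // ltW.
case=> c; rewrite inE => /andP[cov_sc /eqP lab_c] ->.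
rewrite (lab_join cov_sb cov_sc) ?lab_c // (covers_join cov_sb cov_sc) //.
by apply: contraTneq lt_j => ->; rewrite lab_c ltnn.
Qed.

(** The joins [c `|` b] are distinct: if [c `|` b = c' `|` b], this element is also
    [c' `|` c], hence below [s `|` m j], which [b] is not. *)
Lemma card_covers_lab s b j : covers s b -> (j < lab s b)%N ->
  #|covers_lab b j| = #|covers_lab s j|.
Proof.
move=> cov_sb lt_j; rewrite (covers_lab_join cov_sb lt_j) card_in_imset //.
move=> c c'; rewrite !inE => /andP[cov_c /eqP lab_c] /andP[cov_c' /eqP lab_c'] eq_cb.
apply: contraTeq (lt_j) => neq_c; rewrite -leqNgt lab_le.
have le_j e : lab s e = j -> e <= s `|` m j by move=> <-; rewrite -lab_le.
have cov_b : covers b (c `|` b).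
  apply: (covers_join cov_sb cov_c); apply: contraTneq lt_j => ->.
  by rewrite lab_c ltnn.
have cov_c'c := covers_join cov_c cov_c' neq_c.
suff eq_cc' : c' `|` c = c `|` b.
  by apply: le_trans (leUr b c) _; rewrite -eq_cc' leUx !le_j.
apply: (rk_le_eq rkP); first by rewrite leUx leUl andbT eq_cb leUl.
rewrite (rk_covers rkP cov_c'c) (rk_covers rkP cov_b).
by rewrite (rk_covers rkP cov_c) (rk_covers rkP cov_sb).
Qed.

(** * Labels above an element, descents and widths *)

Local Notation la := (labels_above lab).

Lemma labels_above_sorted s : sorted <%O (la s).
Proof. by rewrite sort_lt_sorted undup_uniq. Qed.

Lemma mem_labels_above s j : (j \in la s) = (0 < #|covers_lab s j|)%N.
Proof.
rewrite mem_sort mem_undup card_gt0; apply/mapP/set0Pn => [[t]|[t]].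
  by rewrite mem_filter => /andP[cov_st _] ->; exists t; rewrite inE cov_st /=.
by rewrite inE => /andP[cov_st /eqP <-]; exists t; rewrite // mem_filter cov_st mem_enum.
Qed.

Lemma lab_in_labels_above s t : covers s t -> lab s t \in la s.
Proof.
move=> cov_st; rewrite mem_labels_above card_gt0; apply/set0Pn.
by exists t; rewrite inE cov_st /=.
Qed.

Lemma labels_above_lt s b : covers s b ->
  [seq j <- la b | (j < lab s b)%N] = [seq j <- la s | (j < lab s b)%N].
Proof.
move=> cov_sb; apply: lt_sorted_eq; rewrite ?lt_sorted_filter ?labels_above_sorted // => j.
rewrite !mem_filter; apply: andb_id2l => lt_j.
by rewrite !mem_labels_above (card_covers_lab cov_sb).
Qed.

Lemma labels_above_take s b : covers s b ->
  [seq j <- la s | (j < lab s b)%N] = take (index (lab s b) (la s)) (la s).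
Proof.
move=> /lab_in_labels_above lab_in.
by rewrite -(filter_lt_nth 0%N) ?labels_above_sorted ?index_mem // nth_index.
Qed.

Lemma des_Ind s b : covers s b -> des lab s b = (Ind lab s b).-1.
Proof.
move=> cov_sb; rewrite /des -size_filter [filter _ _]labels_above_lt //.
by rewrite labels_above_take // size_takel // ltnW // index_mem lab_in_labels_above.
Qed.

Definition widths s : seq nat := [seq #|covers_lab s j| | j <- la s].

Lemma widthE s i : (0 < i)%N -> width lab s i = nth 0%N (widths s) i.-1.
Proof.
case: i => // i _; rewrite /width /=; have [le_i|lt_i] := leqP (size (la s)) i.
  rewrite nth_default ?size_map //; apply/eqP; rewrite cards_eq0; apply/eqP/setP=> t.
  by rewrite !inE onth_default // andbF.
rewrite (nth_map 0%N) //; apply: eq_card => t; rewrite !inE.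
rewrite onthE (nth_map 0%N) //.
by rewrite eq_sym.
Qed.

Lemma widths_gt0 s : all (fun x => 0 < x)%N (widths s).
Proof. by apply/allP=> _ /mapP[j + ->]; rewrite mem_labels_above. Qed.

Lemma widths_take s b (k := index (lab s b) (la s)) : covers s b ->
  take k (widths s) = take k (widths b).
Proof.
move=> cov_sb; pose F := [seq j <- la s | (j < lab s b)%N].
have take_s : take k (la s) = F by rewrite /F labels_above_take.
have take_b : take k (la b) = F.
  rewrite /F -(labels_above_lt cov_sb) [RHS](sorted_filter_lt (lab s b)).
    rewrite -size_filter [filter _ _](labels_above_lt cov_sb) -/F -take_s.
    by rewrite size_takel // index_size.
  by have := labels_above_sorted b; rewrite lt_sorted_uniq_le => /andP[].
rewrite -!map_take take_s take_b; apply/eq_in_map => j.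
by rewrite mem_filter => /andP[lt_j _]; rewrite (card_covers_lab cov_sb).
Qed.

Lemma sum_over_labels s (F : nat -> nat) :
  (\sum_(j <- la s) #|covers_lab s j| * F j = \sum_(t | covers s t) F (lab s t))%N.
Proof.
apply: sum_by_value; first exact: lt_sorted_uniq (labels_above_sorted s).
exact: lab_in_labels_above.
Qed.

Lemma sum_widths s : (\sum_(x <- widths s) x = #|[set t | covers s t]|)%N.
Proof.
rewrite big_map -sum1dep_card -(sum_over_labels s (fun=> 1%N)).
by apply: eq_bigr => j _; rewrite muln1.
Qed.

Definition num_smaller_label s b := #|[set c | covers s c & (lab s c < lab s b)%N]|.

(** The sum of the squares counts the pairs of covers of [s] with equal labels;
    the pairs with distinct labels come in two orders, whence the double. *)
Lemma sum_sqr_widths s :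
  (\sum_(x <- widths s) x ^ 2 + (\sum_(b | covers s b) num_smaller_label s b).*2
   = #|[set t | covers s t]| ^ 2)%N.
Proof.
rewrite big_map; under eq_bigr do rewrite -mulnn.
rewrite sum_over_labels -addnn.
have lowerE : (\sum_(b | covers s b) num_smaller_label s b =
    \sum_(b | covers s b) #|[set c | covers s c & (lab s b < lab s c)%N]|)%N.
  rewrite /num_smaller_label.
  under eq_bigr do rewrite -sum1dep_card big_mkcondr.
  under [RHS]eq_bigr do rewrite -sum1dep_card big_mkcondr.
  by rewrite exchange_big.
rewrite {2}lowerE -!big_split -mulnn -sum_nat_cond_const /=.
apply: eq_bigr => b cov_sb; rewrite /num_smaller_label -!sum1dep_card.
(* [covers s c] unfolds to a conjunction, which would be split as well. *)
move: (covers s) => C; rewrite !big_mkcondr -!big_split; apply: eq_bigr => c _ /=.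
by case: ltngtP.
Qed.

(** Falling two-step paths through [b] correspond to pairs of covers of [s]. *)
Lemma num_smaller_label_join s b : covers s b ->
  #|[set y | covers b y & (lab b y < lab s b)%N]| = num_smaller_label s b.
Proof.
move=> cov_sb; rewrite /num_smaller_label -!sum1dep_card.
have count_lt u : (\sum_(y | covers u y && (lab u y < lab s b)) 1 =
    \sum_(j <- iota 0 (lab s b)) #|covers_lab u j|)%N.
  rewrite -(@sum_by_value _ _ (lab u) (iota 0 (lab s b)) (fun=> 1%N)) ?iota_uniq //.
    apply: eq_big_seq => j; rewrite mem_iota /= => lt_j; rewrite muln1.
    apply: eq_card => y; rewrite !inE -andbA; congr (_ && _).
    by case: eqP => [->|]; rewrite ?lt_j ?andbF.
  by move=> y /andP[_ lt_y]; rewrite mem_iota.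
rewrite !count_lt; apply: eq_big_seq => j; rewrite mem_iota /= => lt_j.
exact: card_covers_lab.
Qed.

(** * Widths depend only on the rank *)

Definition num_above s k := #|[set u | (s <= u) && (rk u == rk s + k)%N]|.

(** Each element two ranks above [s] ends exactly one rising path from [s], since
    the labeling is an EL-labeling. *)
Lemma num_above2 s : num_above s 2 =
  (\sum_(b | covers s b) #|[set y | covers b y & (lab s b <= lab b y)%N]|)%N.
Proof.
rewrite /num_above -sum1dep_card; under [RHS]eq_bigr do rewrite -sum1dep_card.
rewrite (exchange_big_dep (fun u => (s <= u) && (rk u == rk s + 2)%N)) /=; last first.
  move=> b y cov_sb /andP[cov_by _].
  rewrite (le_trans (ltW (covers_lt cov_sb)) (ltW (covers_lt cov_by))).
  by rewrite (rk_covers rkP cov_by) (rk_covers rkP cov_sb) addn2 /=.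
apply: eq_bigr => y /andP[le_sy /eqP rk_y]; rewrite sum1dep_card.
have [q [max_q sort_q uniq_q _]] := lab_EL le_sy.
have := rk_maxchain rkP max_q; rewrite rk_y => /addnI.
case: q max_q sort_q uniq_q => [|b [|y' [|? ?]]] //= max_q sort_q uniq_q _.
have y'_eq : y' = y by case/andP: max_q => _ /eqP.
rewrite y'_eq {y' y'_eq} in max_q sort_q uniq_q.
rewrite -(cards1 b); apply: eq_card => c; rewrite !inE; apply/eqP/and3P => [->|].
  by move: max_q sort_q; rewrite !maxchain_cons !andbT => /and3P[-> -> _].
case=> cov_sc cov_cy le_cy.
have max_c : maxchain s y [:: c; y].
  by rewrite !maxchain_cons cov_sc cov_cy /maxchain /=.
by have := uniq_q _ max_c; rewrite /= andbT => /(_ le_cy)[].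
Qed.

(** The witness is a cover [b] of [s] with the largest label. *)
Lemma widths_take_last s : (0 < #|[set t | covers s t]|)%N ->
  exists2 b, covers s b &
    take (size (widths s)).-1 (widths s) = take (size (widths s)).-1 (widths b).
Proof.
rewrite card_gt0 => /set0Pn[t]; rewrite inE => /lab_in_labels_above.
case la_s : (la s) => [//|j l] _.
have: last j l \in la s by rewrite la_s mem_last.
rewrite mem_labels_above card_gt0 => /set0Pn[b].
rewrite inE => /andP[cov_sb /eqP lab_b]; exists b => //.
have /= := widths_take cov_sb; rewrite lab_b la_s index_last ?size_map ?la_s //.
by rewrite -la_s; apply: lt_sorted_uniq (labels_above_sorted s).
Qed.

(** A path [s <. b <. y] is either rising or falling. *)
Lemma sum_card_covers s :
  (num_above s 2 + \sum_(b | covers s b) num_smaller_label s b =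
   \sum_(b | covers s b) #|[set y | covers b y]|)%N.
Proof.
rewrite num_above2 -big_split; apply: eq_bigr => b cov_sb /=.
rewrite -(num_smaller_label_join cov_sb) -!sum1dep_card.
(* [covers b y] unfolds to a conjunction, which would be split as well. *)
move: (covers b) => C; rewrite !big_mkcondr -big_split /=.
by apply: eq_bigr => y _; case: leqP.
Qed.

Lemma num_above1 s : num_above s 1 = #|[set t | covers s t]|.
Proof. by apply: eq_card => t; rewrite !inE (coversE rkP) addn1. Qed.

Context (unif : rank_uniform rk).

Lemma eq_widths_of_rank s s' : rk s = rk s' -> widths s = widths s'.
Proof.
have [n] := ubnP (rk \top - rk s)%N; elim: n s s' => // n IHn s s' lt_n rk_eq.
have card_eq u u' : rk u = rk u' -> #|[set t | covers u t]| = #|[set t | covers u' t]|.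
  by move=> rk_u; rewrite -!num_above1; apply: unif.
have sum_eq := card_eq _ _ rk_eq; rewrite -!sum_widths in sum_eq.
have [no_cov|cov_gt0] := posnP #|[set t | covers s t]|.
  have nil_widths u : #|[set t | covers u t]| = 0%N -> widths u = [::].
    rewrite -sum_widths; case: (widths u) (widths_gt0 u) => //= x l /andP[x_gt0 _].
    by rewrite big_cons; lia.
  by rewrite !nil_widths // -(card_eq _ _ rk_eq).
have [b cov_b take_b] := widths_take_last cov_gt0.
rewrite (card_eq _ _ rk_eq) in cov_gt0.
have [b' cov_b' take_b'] := widths_take_last cov_gt0.
have rk_b : rk b = rk b'.
  by rewrite (rk_covers rkP cov_b) (rk_covers rkP cov_b') rk_eq.
have widths_b : widths b = widths b'.
  have le_b : (rk b <= rk \top)%N := rk_le rkP (lex1 b).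
  by apply: IHn => //; have := rk_covers rkP cov_b; lia.
apply: (@eq_from_sum_sum_sqr (widths b)); rewrite ?widths_gt0 ?take_b //.
  by rewrite widths_b.
have lower_eq : (\sum_(c | covers s c) num_smaller_label s c =
    \sum_(c | covers s' c) num_smaller_label s' c)%N.
  have up2 u e : rk e = (rk u).+1 ->
      (\sum_(c | covers u c) #|[set y | covers c y]| =
       #|[set y | covers u y]| * #|[set y | covers e y]|)%N.
    move=> rk_e; rewrite -sum_nat_cond_const; apply: eq_bigr => c cov_uc.
    by apply: card_eq; rewrite (rk_covers rkP cov_uc).
  have above_eq : num_above s 2 = num_above s' 2 by apply: unif.
  have := sum_card_covers s; have := sum_card_covers s'; rewrite above_eq.
  rewrite (up2 s b) ?(rk_covers rkP cov_b) //.
  rewrite (up2 s' b) ?(rk_covers rkP cov_b) ?rk_eq //.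
  by rewrite (card_eq _ _ rk_eq); lia.
have := sum_sqr_widths s; have := sum_sqr_widths s'.
by rewrite lower_eq (card_eq _ _ rk_eq); lia.
Qed.

Lemma lab_rank_uniform_labeled : rank_uniform_labeled rk lab.
Proof.
split=> [s s' rk_eq i i_gt0|s t s' t' cov_st cov_st' _ ind_eq].
  by rewrite !widthE // (eq_widths_of_rank rk_eq).
by rewrite !des_Ind // ind_eq.
Qed.

(** By [des_Ind], [des_rank rk lab k i] is [i.-1] as long as [i] is an index that
    occurs at rank [k], and its default value is [0]. *)
Lemma lab_monotonic : monotonic rk lab.
Proof.
move=> k _ i j i_gt0 le_ij le_j.
have des_le a : (des_rank rk lab k a <= a.-1)%N.
  rewrite /des_rank; case: pickP => // -[s t] /and3P[cov_st _ /eqP <-].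
  by rewrite des_Ind.
have des_j : des_rank rk lab k j = j.-1.
  rewrite /des_rank; case: pickP => [[s t] /and3P[cov_st _ /eqP <-]|none].
    by rewrite des_Ind.
  move: le_j; rewrite /num_labels; case: pickP => [s /eqP rk_s|_]; last by lia.
  case: j le_ij none => [|j] le_ij none lt_j; first by lia.
  have := mem_nth 0%N lt_j; rewrite mem_labels_above card_gt0 => /set0Pn[t].
  rewrite inE => /andP[cov_st /eqP lab_t].
  have := none (s, t); rewrite /= cov_st rk_s eqxx /Ind lab_t index_uniq ?eqxx //.
  exact: lt_sorted_uniq (labels_above_sorted s).
by rewrite des_j (leq_trans (des_le i)) // -!subn1 leq_sub2r.
Qed.

End Labeling.

(** * Conclusion *)

Theorem theorem1p7 (d : Order.disp_t) (L : finTBLatticeType d) (rk : L -> nat) :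
  is_rank rk -> rank_uniform rk -> semimodular rk -> supersolvable L ->
  UMEL_shellable rk.
Proof.
move=> rkP unif smod [_ [p [p_max p_lm]]].
have EL := lab_EL rkP smod p_max p_lm.
have uniform := lab_rank_uniform_labeled rkP smod p_max p_lm unif.
have mono := lab_monotonic rkP smod p_max p_lm.
by do 3!eexists; split; [exact EL | exact uniform | exact mono].
Qed.
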